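(* Let $f\in\mathrm{Hol}(\alpha)$ be a bounded H\''older potential. Then there is at least one equilibrium state $\mu_f$ associated to $f$ whose Yosida-Hewitt decomposition has only the countably additive part. More precisely, such an equilibrium state is given by $\mu_f=h\nu$ (i.e. $d\mu_f=h\,d\nu$), where $\nu$ is the eigenmeasure of the dual of the Ruelle operator, $\mathscr L_f^*\nu=\lambda_f\nu$, and $h$ is a suitably normalized eigenfunction of $\mathscr L_f$ associated to $\lambda_f$.
   Context: $(E,d_E)$ is a complete separable metric space with its Borel sigma-algebra (a standard Borel space), $p$ is a fixed Borel probability measure on $E$, and $X=E^{\mathbb N}$ with metric $d_X(x,y)=\sum_{n\ge1}2^{-n}\min\{d_E(x_n,y_n),1\}$ and left shift $\sigma(x_1,x_2,\dots)=(x_2,x_3,\dots)$. $C_b(X,\mathbb R)$ is the Banach space of bounded continuous real functions with the supremum norm. $rba(X)$ is the space of bounded, regular, finitely additive signed measures on the Borel sigma-algebra of $X$ (regular: for each Borel $A$ and $\varepsilon>0$ there are a closed $F\subset A$ and an open $O\supset A$ with $|\mu(C)|<\varepsilon$ for all Borel $C\subset O\setminus F$), identified with $C_b(X,\mathbb R)^*$ via integration $\langle\mu,f\rangle=\mu(f)=\int_Xf\,d\mu$. $\mathscr M_1^a(X)=\{\mu\in rba(X):\mu(1)=1,\ \mu(f)\ge0\ \forall f\in C_b(X,\mathbb R), f\ge 0\}$ and $\mathscr M^a_\sigma(X)=\{\mu\in\mathscr M_1^a(X):\mu(f\circ\sigma)=\mu(f)\ \forall f\in C_b(X,\mathbb R)\}$.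 Yosida-Hewitt decomposition: every non-negative $\mu\in rba(X)$ is uniquely $\mu=\mu_c+\mu_a$ with $\mu_c\ge0$ countably additive and $\mu_a\ge0$ purely finitely additive, i.e. any non-negative countably additive $\kappa\le\mu_a$ is $0$. Fix $0<\alpha<1$; $\mathrm{Hol}(\alpha)=\{f\in C_b(X,\mathbb R):\mathrm D_\alpha(f)<\infty\}$, $\mathrm D_\alpha(f)=\sup_{x\ne y}|f(x)-f(y)|/d_X(x,y)^\alpha$. The Ruelle operator is $\mathscr L_f\varphi(x)=\int_Ee^{f(ax)}\varphi(ax)\,dp(a)$, $ax=(a,x_1,x_2,\dots)$, with dual $\mathscr L_f^*$ on $rba(X)$. For $g\in\mathrm{Hol}(\alpha)$ there is a unique countably additive Borel probability measure $\nu_g$ with $\mathscr L_g^*\nu_g=\lambda_g\nu_g$ for some $\lambda_g>0$, and, up to scalar multiples, a unique H\''older function $h_g$, bounded away from $0$ and $\infty$, with $\mathscr L_gh_g=\lambda_gh_g$. In the claim $\nu=\nu_f$, and $h$ is $h_f$ normalized by $\int h\,d\nu=1$. The entropy of $\mu\in rba(X)$ is $\mathrm h^{\mathrm v}(\mu)=\inf_{g\in\mathrm{Hol}(\alpha)}\big(-\langle\mu,g\rangle+\log\lambda_g\big)\in[-\infty,\infty)$. An equilibrium state for $f\in C_b(X,\mathbb R)$ is a $\mu\in\mathscr M^a_\sigma(X)$ with $\mathrm h^{\mathrm v}(\mu)+\langle\mu,f\rangle=\sup_{\kappa\in\mathscr M^a_\sigma(X)}\mathrm h^{\mathrm v}(\kappa)+\langle\kappa,f\rangle$.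 *)

(* Defs.v *)
From HB Require Import structures.
From mathcomp Require Import all_boot all_order all_algebra.
From mathcomp Require Import all_classical all_reals all_analysis.
Import Order.TTheory GRing.Theory Num.Theory.
Import numFieldNormedType.Exports HBSimple.

Set Implicit Arguments.
Unset Strict Implicit.
Unset Printing Implicit Defensive.

Local Open Scope classical_set_scope.
Local Open Scope ring_scope.

(* The library's complete structures are pointed; this is no restriction for a
   space that carries a probability measure. *)
#[short(type="completeMetricType")]
HB.structure Definition CompleteMetric (R : numDomainType) :=
  {E of Metric R E & CompletePseudoMetric R E}.

Definition separable (T : topologicalType) :=
  exists2 D : set T, countable D & dense D.

Notation borelType T := (g_sigma_algebraType (@open T)).

(* E^N, as an alias of [nat -> E] so that it carries the metric d_X below and
   not the structures that the library puts on function types. Coordinates are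
   numbered from 0, so [x n] is the coordinate x_(n+1) of the mathematics. *)
Definition seqspace (R : realType) (E : completeMetricType R) : Type :=
  nat -> E.

Section seqspace_metric.
Context {R : realType} {E : completeMetricType R}.
Local Notation X := (@seqspace R E).
Implicit Types x y z : X.

HB.instance Definition _ := gen_eqMixin X.
HB.instance Definition _ := gen_choiceMixin X.
HB.instance Definition _ := isPointed.Build X (fun=> point).

Definition seqdist_term x y (n : nat) : R :=
  2 ^- n.+1 * Num.min (mdist (x n) (y n)) 1.

Definition seqdist x y : R := limn (series (seqdist_term x y)).

Lemma seqdist_term_ge0 x y n : 0 <= seqdist_term x y n.
Proof.
by rewrite mulr_ge0 ?invr_ge0 ?exprn_ge0// le_min mdist_ge0 ler01.
Qed.

Lemma seqdist_term_le x y n : seqdist_term x y n <= geometric 2^-1 2^-1 n.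
Proof.
rewrite /seqdist_term /= -exprVn exprS ler_piMr ?mulr_ge0 ?exprn_ge0//.
by rewrite ge_min lexx orbT.
Qed.

Lemma is_cvg_seqdist x y : cvgn (series (seqdist_term x y)).
Proof.
apply: (series_le_cvg (seqdist_term_ge0 x y) _ (seqdist_term_le x y)).
  by move=> n /=; rewrite mulr_ge0 ?exprn_ge0.
by apply: is_cvg_geometric_series; rewrite ger0_norm// invf_lt1// ltr1n.
Qed.

Lemma seqdistxx x : seqdist x x = 0.
Proof.
rewrite /seqdist (_ : series _ = fun=> 0) ?lim_cst//.
apply/funext => n; rewrite /series/= big1// => i _.
by rewrite /seqdist_term mdistxx min_l ?mulr0.
Qed.

Lemma seqdist_sym x y : seqdist x y = seqdist y x.
Proof.
rewrite /seqdist; congr (limn (series _)); apply/funext => n.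
by rewrite /seqdist_term metric_sym.
Qed.

Lemma seqdist_positivity x y : seqdist x y = 0 -> x = y.
Proof.
move=> xy0; apply/funext => n; apply: (@mdist_positivity R).
have nd : nondecreasing_seq (series (seqdist_term x y)).
  apply/nondecreasing_seqP => k; rewrite -subr_ge0 seriesSB.
  exact: seqdist_term_ge0.
have : series (seqdist_term x y) n.+1 <= 0.
  rewrite -xy0 /seqdist; exact: nondecreasing_cvgn_le nd (@is_cvg_seqdist x y) _.
rewrite /series/= big_nat_recr//= => le0.
have /eqP : seqdist_term x y n = 0.
  apply/eqP; rewrite eq_le seqdist_term_ge0 andbT (le_trans _ le0)// lerDr.
  by apply: sumr_ge0 => i _; exact: seqdist_term_ge0.
rewrite mulf_eq0 invr_eq0 expf_eq0/= pnatr_eq0/=.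
by rewrite /Num.min; case: ifPn => [_ /eqP//|_]; rewrite oner_eq0.
Qed.

Lemma seqdist_triangle y x z : seqdist x z <= seqdist x y + seqdist y z.
Proof.
rewrite /seqdist -limD; [|exact: is_cvg_seqdist..].
apply: ler_lim; first exact: is_cvg_seqdist.
  by apply: is_cvgD; exact: is_cvg_seqdist.
apply: nearW => n.
rewrite -[leRHS]/(series (seqdist_term x y) n + series (seqdist_term y z) n).
rewrite /series/= -big_split/=; apply: ler_sum => i _.
rewrite /seqdist_term -mulrDr ler_wpM2l ?invr_ge0 ?exprn_ge0//.
have := metric_triangle (x i) (y i) (z i).
have := @mdist_ge0 R E (x i) (y i); have := @mdist_ge0 R E (y i) (z i).
move: (mdist (x i) (z i)) (mdist (x i) (y i)) (mdist (y i) (z i)) => a b c.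
move=> c0 b0 abc; rewrite ge_min.
have [b1|b1] := leP b 1; have [c1|c1] := leP c 1.
- by rewrite abc.
- by rewrite lerDr b0 orbT.
- by rewrite lerDl c0 orbT.
- by rewrite lerDl ler01 orbT.
Qed.

HB.instance Definition _ := @isMetric.Build R X seqdist seqdistxx
  seqdist_positivity seqdist_sym seqdist_triangle.

Definition shift (x : X) : X := fun n => x n.+1.

Definition prepend (a : E) (x : X) : X :=
  fun n => if n is m.+1 then x m else a.

End seqspace_metric.

Section thermodynamic_formalism.
Context {R : realType} {E : completeMetricType R}.
Local Notation X := (@seqspace R E).
Local Notation BX := (borelType X).
Implicit Types (f g h phi : X -> R) (mu : set BX -> \bar R).

Definition Cb f := continuous f /\ bounded_fun f.

Definition holder_seminorm (alpha : R) f : \bar R :=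
  ereal_sup [set (`|f xy.1 - f xy.2| / mdist xy.1 xy.2 `^ alpha)%:E
            | xy in [set xy : X * X | xy.1 <> xy.2]].

Definition Hol (alpha : R) f := Cb f /\ (holder_seminorm alpha f < +oo)%E.

(* [fa_integral mu f] is the integral of a bounded Borel function f against a
   bounded finitely additive mu: the only real v such that f can be
   approximated uniformly by simple functions whose elementary integrals tend
   to v. (The library's integral is for countably additive measures.) *)
Definition fa_integral mu f : R :=
  get [set v : R | forall e : R, 0 < e ->
    exists s : {sfun BX >-> R}, (forall x, `|f x - s x| <= e) /\
      `|fine (sintegral mu s) - v| <= e].

Definition nonneg_setfun mu := forall A, measurable A -> (0 <= mu A)%E.

Definition regular_setfun mu :=
  forall (A : set X) (e : R), measurable (A : set BX) -> 0 < e ->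
  exists F O : set X, [/\ closed F, F `<=` A, open O, A `<=` O &
    forall C : set BX, measurable C -> C `<=` O `\` F -> (`|mu C| < e%:E)%E].

Definition bounded_setfun mu :=
  exists M : R, forall A, measurable A -> (`|mu A| <= M%:E)%E.

Definition rba (mu : {additive_charge set BX -> \bar R}) :=
  bounded_setfun mu /\ regular_setfun mu.

Definition M1a (mu : {additive_charge set BX -> \bar R}) :=
  [/\ rba mu, fa_integral mu (cst 1) = 1 &
      forall f, Cb f -> (forall x, 0 <= f x) -> 0 <= fa_integral mu f].

Definition Msigma (mu : {additive_charge set BX -> \bar R}) :=
  M1a mu /\ forall f, Cb f -> fa_integral mu (f \o shift) = fa_integral mu f.

Definition purely_finitely_additive mu :=
  forall kappa : {measure set BX -> \bar R},
    (forall A, measurable A -> (kappa A <= mu A)%E) ->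
    forall A, measurable A -> kappa A = 0%E.

Definition yosida_hewitt (mu mu_c mu_a : {additive_charge set BX -> \bar R}) :=
  [/\ rba mu_c /\ rba mu_a,
      forall A, measurable A -> mu A = (mu_c A + mu_a A)%E,
      nonneg_setfun mu_c /\ semi_sigma_additive mu_c &
      nonneg_setfun mu_a /\ purely_finitely_additive mu_a].

(* the decomposition of mu consists of its countably additive part only *)
Definition only_countably_additive
    (mu : {additive_charge set BX -> \bar R}) :=
  exists mu_c mu_a : {additive_charge set BX -> \bar R},
    yosida_hewitt mu mu_c mu_a /\ forall A, measurable A -> mu_a A = 0%E.

Context (p : probability (borelType E) R).

Definition ruelle f phi : X -> R :=
  fun x => \int[p]_a (expR (f (prepend a x)) * phi (prepend a x)).

Definition ruelle_dual f mu : (X -> R) -> R :=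
  fun phi => fa_integral mu (ruelle f phi).

(* L_f^* nu = lambda nu as functionals on C_b *)
Definition ruelle_eigenmeasure f (lambda : R) (nu : probability BX R) :=
  forall phi, Cb phi -> ruelle_dual f nu phi = lambda * fa_integral nu phi.

(* lambda is the number written lambda_g in the literature; it is determined
   by g, so it is handled as a relation rather than as a function of g. *)
Definition ruelle_eigenvalue g (lambda : R) :=
  0 < lambda /\ exists nu, ruelle_eigenmeasure g lambda nu.

Definition ruelle_eigenfunction (alpha : R) f (lambda : R) h :=
  [/\ Hol alpha h, exists2 c : R, 0 < c & forall x, c <= h x &
      forall x, ruelle f h x = lambda * h x].

Definition entropy (alpha : R) mu : \bar R :=
  ereal_inf [set (- fa_integral mu gl.1 + ln gl.2)%:E
            | gl in [set gl : (X -> R) * R |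
                     Hol alpha gl.1 /\ ruelle_eigenvalue gl.1 gl.2]].

Definition equilibrium_state (alpha : R) f
    (mu : {additive_charge set BX -> \bar R}) :=
  Msigma mu /\
  (entropy alpha mu + (fa_integral mu f)%:E)%E =
  ereal_sup [set (entropy alpha kappa + (fa_integral kappa f)%:E)%E
            | kappa in [set kappa | Msigma kappa]].

End thermodynamic_formalism.

(* Main.v *)
Require Import Defs.
From HB Require Import structures.
From mathcomp Require Import all_boot all_order all_algebra.
From mathcomp Require Import all_classical all_reals all_analysis.
From mathcomp Require Import measurable_realfun ring lra.
Import Order.TTheory GRing.Theory Num.Theory.
Import numFieldNormedType.Exports HBSimple.
Local Open Scope classical_set_scope.
Local Open Scope ring_scope.

Set Implicit Arguments.
Unset Strict Implicit.

(** Write L_f for the Ruelle operator and let mu be the measure h nu. Since mu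
    is a finite Borel measure on a metric space it is regular
    ([borel_measure_regular]), so it is an element of rba, and the finitely
    additive integral against it is the Lebesgue integral of phi * h against nu
    ([fa_integral_density]). It is invariant because
    L_f ((phi \o shift) * h) = phi * L_f h = lambda phi h
    ([eigenmeasure_shift_invariant]).

    The pair (f, lambda) is itself admissible in the infimum that defines the
    entropy, so the entropy of kappa plus kappa(f) is at most ln lambda for
    every invariant kappa. It remains to see that mu attains this bound: for
    every Hölder g with an eigenmeasure nu_g of eigenvalue lambda_g,

      ln lambda + mu(g - f) <= ln lambda_g,

    i.e. mu is a subgradient at f of the pressure ln lambda_g
    ([pressure_subgradient]). The operator
    psi |-> L_f (h psi) / (lambda h) is an average with weights of total mass 1
    which leaves mu invariant, and L_g phi is lambda h times the average of
    exp (g - f + ln phi - ln h). Jensen's inequality for the logarithm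
    ([ruelle_jensen]), integrated against mu, gives

      mu (ln (L_g phi)) >= ln lambda + mu(g - f) + mu (ln phi),

    hence mu (ln (L_g^n 1)) >= n (ln lambda + mu(g - f)). In the other direction
    the integral of L_g^n 1 against nu_g is lambda_g^n, and bounded distortion
    makes L_g^n 1 comparable to this mean with a constant that does not depend
    on n ([ruelle_distortion], [ruelle_iterates_bound]); so the left-hand side
    is at most K + n ln lambda_g. Dividing by n and letting n grow concludes. *)

(** * Integration against finitely additive set functions with a density *)

Section simple_approximation.
Context d (T : measurableType d) (R : realType).

(** Rounding f down to a multiple of e. The rounded function is written as a
    finite sum of indicators of superlevel sets, which makes its measurability
    immediate. *)
Lemma uniform_sfun_approximation (f : T -> R) (M e : R) :
  measurable_fun setT f -> (forall x, `|f x| <= M) -> 0 < e ->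
  exists s : {sfun T >-> R}, forall x, `|f x - s x| <= e.
Proof.
move=> mf fM e0.
pose t x := (f x + M) / e.
have t0 x : 0 <= t x.
  rewrite divr_ge0 ?(ltW e0)// -lerBlDr sub0r.
  by move: (fM x); rewrite ler_norml => /andP[].
pose N := Num.truncn ((M + M) / e).
have tN x : (Num.truncn (t x) <= N)%N.
  have ME : t x <= (M + M) / e.
    rewrite ler_pM2r ?invr_gt0// lerD2r.
    exact: le_trans (ler_norm _) (fM x).
  rewrite truncn_ge_nat ?(le_trans (t0 x))//.
  by rewrite (le_trans _ ME)// truncn_le.
pose s x := e * (Num.truncn (t x))%:R - M.
have sE : s = fun x => e * (\sum_(i < N) \1_[set x | i.+1%:R <= t x] x) - M.
  apply/funext => x; rewrite /s; congr (_ * _ - _).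
  transitivity (\sum_(i < Num.truncn (t x)) (1 : R)).
    by rewrite sumr_const card_ord.
  rewrite (big_ord_widen N (fun=> 1))// big_mkcond/=.
  apply: eq_bigr => i _; rewrite indicE truncn_gt_nat.
  have [h|h] := boolP (i.+1%:R <= t x); first by rewrite mem_set.
  by rewrite memNset//=; exact/negP.
have ms : measurable_fun setT s.
  rewrite sE; apply: measurable_funB => //; apply: measurable_funM => //.
  apply: measurable_sum => i; apply: measurable_indic.
  have mt : measurable_fun setT t.
    by apply: measurable_funM => //; exact: measurable_funD.
  have := mt measurableT _ (measurable_itv `[i.+1%:R, +oo[).
  by rewrite setTI; congr measurable; apply/seteqP; split=> x /=;
    rewrite in_itv/= andbT.
have fs : finite_set (range s).
  apply: (@sub_finite_set _ (range s) ((fun k : nat => e * k%:R - M) @` `I_N.+1)).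
    by move=> _ [x _ <-]; exists (Num.truncn (t x)) => //=; rewrite ltnS.
  exact/finite_image/finite_II.
have sP : s \in sfun by rewrite !inE; apply/andP; split; rewrite inE/=.
exists (sfun_Sub sP) => x.
change (`|f x - s x| <= e).
have -> : f x - s x = e * (t x - (Num.truncn (t x))%:R).
  by rewrite /s mulrBr /t mulrCA divff ?gt_eqF// mulr1 opprB addrA.
have /andP[h1 h2] := truncn_itv (t0 x).
rewrite normrM (gtr0_norm e0) ger_pMr// ger0_norm ?subr_ge0//.
by rewrite lerBlDr nat1r ltW.
Qed.

(** Only the values of mu on measurable sets enter, so mu need not be packed as a
    measure: the lemma applies to a charge, and with h = 1 to nu itself. *)
Lemma sintegral_density (nu : {measure set T -> \bar R}) (h : T -> R)
    (mu : set T -> \bar R) (s : {sfun T >-> R}) :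
  nu.-integrable setT (EFin \o h) ->
  (forall A, measurable A -> mu A = \int[nu]_(x in A) (h x)%:E)%E ->
  sintegral mu s = (\int[nu]_x (s x * h x)%:E)%E.
Proof.
move=> ih muE.
have m1 y : measurable (s @^-1` [set y]) by exact: measurable_sfunP.
have ih1 y : nu.-integrable setT (fun x => (\1_(s @^-1` [set y]) x * h x)%:E).
  have ihy := integrableS measurableT (m1 y) (@subsetT _ _) ih.
  move/(integrable_mkcond _ (m1 y)) : ihy.
  apply: eq_integrable => // x _; rewrite patchE indicE.
  by case: ifPn => _ /=; rewrite ?mul1r ?mul0r.
(* Values outside the range of s have an empty fibre, which is mu-null. *)
have -> : sintegral mu s =
    (\sum_(y \in range s) y%:E * mu (s @^-1` [set y]))%E.
  rewrite /sintegral (fsbig_widen (range s) setT)//= => x [_ Nfx] /=.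
  by rewrite preimage10// muE// integral_set0 mule0.
rewrite fsbig_finite//=; set Y := finmap.enum_fset _.
transitivity (\int[nu]_x (\sum_(y <- Y)
   (y%:E * (\1_(s @^-1` [set y]) x * h x)%:E)))%E.
  rewrite integral_sum//; last by move=> y; exact: integrableZl.
  apply: eq_bigr => y _; rewrite integralZl// muE// integral_mkcond.
  congr (_ * _)%E; apply: eq_integral => x _; rewrite patchE indicE.
  by case: ifPn => _ /=; rewrite ?mul1r ?mul0r.
apply: eq_integral => x _; rewrite fimfunE fsbig_finite//= mulr_suml -sumEFin.
by apply: eq_bigr => y _; rewrite -EFinM mulrA.
Qed.

End simple_approximation.

Section density.
Context d (T : measurableType d) (R : realType).
Variables (nu : {measure set T -> \bar R}) (h : T -> R).
Hypotheses (h0 : forall x, 0 <= h x) (ih : nu.-integrable setT (EFin \o h)).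

Lemma integrable_bounded_density (f : T -> R) (M : R) :
  measurable_fun setT f -> (forall x, `|f x| <= M) ->
  nu.-integrable setT (EFin \o (fun x => f x * h x)).
Proof.
move=> mf fM.
have mh : measurable_fun setT h.
  by apply/measurable_EFinP; exact: measurable_int ih.
apply: (le_integrable measurableT _ _ (integrableZl measurableT M ih)).
  by apply/measurable_EFinP; exact: measurable_funM.
move=> x _ /=; rewrite lee_fin normrM (ger0_norm (h0 x)).
rewrite [leRHS]ger0_norm ?ler_wpM2r//.
by rewrite mulr_ge0// (le_trans _ (fM x)).
Qed.

Lemma Rintegral_density_bound (f : T -> R) (M : R) :
  measurable_fun setT f -> (forall x, `|f x| <= M) ->
  `|\int[nu]_x (f x * h x)| <= M * \int[nu]_x h x.
Proof.
move=> mf fM.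
have ifh := integrable_bounded_density mf fM.
rewrite -RintegralZl//; apply: (le_trans (le_normr_Rintegral _ ifh)) => //.
apply: le_Rintegral => //.
- by have := integrable_norm ifh.
- exact: (integrableZl measurableT M ih).
- by move=> x _; rewrite normrM (ger0_norm (h0 x)) ler_wpM2r.
Qed.

End density.

Section fa_integral_density.
Context {R : realType} {E : completeMetricType R}.
Local Notation X := (@seqspace R E).
Local Notation BX := (borelType X).

(** The elementary integral of s differs from the integral of f * h by at most
    the uniform distance of f and s. So the latter number has the property that
    specifies [fa_integral], and any other number with this property is
    arbitrarily close to it. *)
Lemma fa_integral_density (nu : {measure set BX -> \bar R}) (h : BX -> R)
    (mu : set BX -> \bar R) (f : BX -> R) (M : R) :
  (forall x, 0 <= h x) -> nu.-integrable setT (EFin \o h) ->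
  \int[nu]_x h x = 1 ->
  (forall A, measurable A -> mu A = \int[nu]_(x in A) (h x)%:E)%E ->
  measurable_fun setT f -> (forall x, `|f x| <= M) ->
  fa_integral mu f = \int[nu]_x (f x * h x).
Proof.
move=> h0 ih h1 muE mf fM.
set v0 := \int[nu]_x (f x * h x).
have key (e : R) (s : {sfun BX >-> R}) : (forall x, `|f x - s x| <= e) ->
    `|fine (sintegral mu s) - v0| <= e.
  move=> fs; rewrite (sintegral_density s ih muE) distrC /v0.
  rewrite -[fine _]/(\int[nu]_x (s x * h x)).
  have sM x : `|s x| <= M + e.
    rewrite -[s x](subrK (f x)) (le_trans (ler_normD _ _))// addrC.
    by rewrite lerD// distrC.
  rewrite -RintegralB//.
  - under eq_Rintegral do rewrite -mulrBl.
    rewrite -[leRHS]mulr1 -h1; apply: Rintegral_density_bound => //.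
    by apply: measurable_funB => //; exact: measurable_funPT.
  - exact: integrable_bounded_density fM.
  - exact: integrable_bounded_density sM.
rewrite /fa_integral; set P := (X in get X).
have P0 : P v0.
  move=> e e0; have [s fs] := uniform_sfun_approximation mf fM e0.
  by exists s; split => //; exact: key.
have : P (get P) by apply: getPex; exists v0.
move: (get P) => v Pv.
apply/eqP; rewrite -subr_eq0 -normr_le0; apply/ler_addgt0Pl => e e0.
have [s [/key sv0 sg]] := Pv (e / 2) (divr_gt0 e0 (ltr0Sn _ _)).
rewrite addr0 [leRHS]splitr -[_ - v0](subrKA (fine (sintegral mu s))).
by rewrite (le_trans (ler_normD _ _))// lerD// distrC.
Qed.

End fa_integral_density.

(** * Regularity of finite Borel measures on metric spaces *)

Section borel.
Context {R : realType} {T : pseudoPMetricType R}.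
Local Notation BT := (borelType T).

Lemma open_borel (A : set BT) : open (A : set T) -> measurable A.
Proof. by move=> oA; apply: sub_sigma_algebra. Qed.

Lemma closed_borel (A : set BT) : closed (A : set T) -> measurable A.
Proof.
by move=> cA; rewrite -(setCK A); apply: measurableC; apply: open_borel;
  exact: closed_openC.
Qed.

Lemma continuous_borel (f : T -> R) :
  continuous f -> measurable_fun (setT : set BT) (f : BT -> R).
Proof.
move=> /continuousP cf.
apply: (measurability _ (RGenOpens.measurableE R)) => //.
move=> _ [_ [a [b ->] <-]]; rewrite setTI; apply: open_borel.
exact/cf/interval_open.
Qed.

Variable mu : {measure set BT -> \bar R}.
Hypothesis mu_fin : (mu setT < +oo)%E.

Lemma nonincreasing_measure_lt (G : (set BT)^nat) (e : \bar R) :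
  (forall n, measurable (G n)) -> {homo G : n m / (n <= m)%N >-> (m <= n)%O} ->
  (mu (\bigcap_n G n) < e)%E -> exists N, (mu (G N) < e)%E.
Proof.
move=> mG dG Ge.
have G0 : (mu (G 0%N) < +oo)%E.
  by rewrite (le_lt_trans _ mu_fin)// le_measure ?inE.
have mcap : measurable (\bigcap_n G n) by exact: bigcapT_measurable.
have := nonincreasing_cvg_mu G0 mG mcap dG.
move=> /(_ [set y | (y < e)%E]) [].
  by apply: open_nbhs_nbhs; split; [exact: open_ereal_lt_ereal|].
by move=> N _ /(_ N (leqnn N)) ?; exists N.
Qed.

(** A closed set is the decreasing intersection of its open neighbourhoods of
    radius 1/(n+1), so continuity from above applies. Interiors of balls are
    taken because a ball of a pseudometric structure need not be open. *)
Lemma closed_outer_approximation (A : set T) (e : R) : closed A -> 0 < e ->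
  exists O : set T, [/\ open O, A `<=` O & (mu (O `\` A) < e%:E)%E].
Proof.
move=> cA e0.
pose O n : set T := \bigcup_(x in A) (ball x n.+1%:R^-1)°.
have oO n : open (O n) by apply: bigcup_open => x _; exact: open_interior.
have AO n : A `<=` O n.
  by move=> x Ax; exists x => //; exact: nbhsx_ballx.
have [| | |N muN] := @nonincreasing_measure_lt (fun n => O n `\` A) e%:E.
- by move=> n; apply: measurableD; [exact: open_borel|exact: closed_borel].
- move=> n m nm; rewrite subsetEset; apply: setSD => y [x Ax xy].
  exists x => //; move: xy; apply: interiorS; apply: le_ball.
  by rewrite lef_pV2 ?posrE// ler_nat.
- rewrite (_ : \bigcap_n _ = set0) ?measure0//.
  rewrite -subset0 => y yO /=; have [_ nAy] := yO 0%N I.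
  apply: nAy; rewrite (proj1 (closure_id A) cA) => B.
  rewrite -nbhs_ballE => -[r /= r0 rB].
  have [n nr] : exists n, n.+1%:R^-1 < r.
    by have [n _ /(_ n (leqnn n))] := near_infty_natSinv_lt (PosNum r0); exists n.
  have [[x Ax xy] _] := yO n I; exists x; split => //; apply: rB.
  by apply: ball_sym; apply: (le_ball (ltW nr)); exact: interior_subset xy.
by exists (O N).
Qed.

(** The sets for which regularity holds form a sigma-algebra containing the open
    sets. *)
Let approximable : set_system T := [set A : set T | measurable (A : set BT) /\
  forall e : R, 0 < e -> exists F O : set T,
    [/\ closed F, F `<=` A, open O, A `<=` O & (mu (O `\` F) < e%:E)%E]].

Let approximable_sigma_algebra : sigma_algebra setT approximable.
Proof.
split.
- split=> // e e0; exists set0, set0; split => //; first exact: closed0.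
    exact: open0.
  by rewrite setD0 measure0.
- move=> A [mA AP]; rewrite setTD; split; first exact: measurableC.
  move=> e /AP[F [U [cF FA oU AU FU]]].
  exists (~` U), (~` F); split; [exact: open_closedC|exact: subsetC|
    exact: closed_openC|exact: subsetC|].
  by rewrite setDE setCK setIC -setDE.
move=> A AP; have mA n : measurable (A n : set BT) by have [] := AP n.
split; first exact: bigcupT_measurable.
move=> e e0.
have /choice [W WP] : forall n, exists W : set T * set T,
    [/\ closed W.1, W.1 `<=` A n, open W.2, A n `<=` W.2 &
      (mu (W.2 `\` W.1) < ((e / 2) / (2 ^ n.+1)%:R)%:E)%E].
  move=> n; have [_ /(_ ((e / 2) / (2 ^ n.+1)%:R))] := AP n.
  case; first by rewrite !divr_gt0// ltr0n expn_gt0.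
  by move=> F [U WP]; exists (F, U).
pose F n := (W n).1; pose O := \bigcup_n (W n).2.
have mF n : measurable (F n : set BT).
  by apply: closed_borel; have [] := WP n.
have mO n : measurable ((W n).2 : set BT).
  by apply: open_borel; have [] := WP n.
have oO : open O by apply: bigcup_open => n _; have [] := WP n.
(* An infinite union of closed sets need not be closed: a finite part of it is
   used, which costs an arbitrarily small amount of measure. *)
pose FU N : set T := \bigcup_(n in `I_N) F n.
have cFU N : closed (FU N).
  by apply: closed_bigcup => [|n _]; [exact: finite_II|have [] := WP n].
have [| | |N muN] := @nonincreasing_measure_lt (fun N => O `\` FU N) e%:E.
- by move=> n; apply: measurableD; [exact: open_borel|exact: closed_borel].
- move=> n m nm; rewrite subsetEset; apply: setDS => x [k /= kn Fx].
  by exists k => //=; exact: leq_trans nm.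
- apply: (@le_lt_trans _ _ (e / 2)%:E); last first.
    by rewrite lte_fin ltr_pdivrMr// ltr_pMr// ltr1n.
  apply: (@le_trans _ _ (\sum_(0 <= n <oo) mu ((W n).2 `\` F n))%E).
    apply: measure_sigma_subadditive.
    + by move=> n; exact: measurableD.
    + apply: bigcapT_measurable => n; apply: measurableD.
        exact: open_borel.
      exact: closed_borel.
    + move=> x xO; have [[n _ On] _] := xO 0%N I; exists n => //; split => // Fx.
      by have [_] := xO n.+1 I; apply; exists n => /=.
  apply: (le_trans _ (epsilon_trick0 xpredT (ltW (divr_gt0 e0 (ltr0Sn _ 1))))).
  apply: lee_nneseries => // n _; have [_ _ _ _ muW] := WP n; exact: ltW.
exists (FU N), O; split => //.
- by move=> x [n _ Fx]; exists n => //; have [_ + _ _ _] := WP n; exact.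
- by apply: subset_bigcup => n _; have [] := WP n.
Qed.

Lemma borel_measure_regular (A : set T) (e : R) : measurable (A : set BT) -> 0 < e ->
  exists F O : set T,
    [/\ closed F, F `<=` A, open O, A `<=` O & (mu (O `\` F) < e%:E)%E].
Proof.
move=> mA; suff [_] : approximable A by exact.
move: A mA; apply: smallest_sub; first exact: approximable_sigma_algebra.
move=> A oA; rewrite -(setCK A) -setTD.
have [_ + _] := approximable_sigma_algebra; apply.
have cA : closed (~` A) by exact: open_closedC.
split; first exact: closed_borel.
move=> e' e'0; have [U [oU AU muU]] := closed_outer_approximation cA e'0.
by exists (~` A), U; split.
Qed.

End borel.

(** * Metric and Hölder functions on the sequence space *)

Section seqspace_distance.
Context {R : realType} {E : completeMetricType R}.
Local Notation X := (@seqspace R E).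
Implicit Types x y : X.

(** Splitting off the first coordinate; the behaviour of [prepend] and of the
    shift with respect to the metric is read off from this identity. *)
Lemma mdist_seqspaceE x y : mdist x y =
  2^-1 * Num.min (mdist (x 0%N) (y 0%N)) 1 +
  2^-1 * mdist (Defs.shift x) (Defs.shift y).
Proof.
change (seqdist x y = 2^-1 * Num.min (mdist (x 0%N) (y 0%N)) 1
                      + 2^-1 * seqdist (Defs.shift x) (Defs.shift y)).
apply: cvg_lim => //; rewrite -cvg_shiftS.
rewrite (_ : (fun n => _) = fun n => 2^-1 * Num.min (mdist (x 0%N) (y 0%N)) 1
   + 2^-1 * series (seqdist_term (Defs.shift x) (Defs.shift y)) n); last first.
  apply/funext => n; rewrite /series/= big_nat_recl//; congr (_ + _).
  rewrite mulr_sumr; apply: eq_bigr => i _.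
  by rewrite /seqdist_term mulrA [in LHS]exprS invfM.
apply: cvgD; first exact: cvg_cst.
by apply: cvgMr; exact: is_cvg_seqdist.
Qed.

Lemma mdist_seqspace_le1 x y : mdist x y <= 1.
Proof.
change (seqdist x y <= 1).
have half1 : `|2^-1 : R| < 1 by rewrite ger0_norm// invf_lt1// ltr1n.
have -> : 1 = limn (series (geometric (2^-1 : R) 2^-1)).
  rewrite (cvg_lim _ (cvg_geometric_series half1))//.
  have -> : 1 - 2^-1 = 2^-1 :> R by field.
  by rewrite divff.
apply: ler_lim; first exact: is_cvg_seqdist.
  exact: is_cvg_geometric_series.
by apply: nearW => n; apply: ler_sum => i _; exact: seqdist_term_le.
Qed.

Lemma mdist_prepend (a : E) x y :
  mdist (prepend a x) (prepend a y) = 2^-1 * mdist x y.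
Proof.
by rewrite mdist_seqspaceE/= mdistxx min_l ?ler01// mulr0 add0r.
Qed.

Lemma mdist_prependl (a b : E) x :
  mdist (prepend a x : X) (prepend b x) <= mdist a b.
Proof.
rewrite mdist_seqspaceE/=.
rewrite (_ : mdist (Defs.shift _) _ = 0) ?mulr0 ?addr0; last by rewrite mdistxx.
rewrite (@le_trans _ _ (2^-1 * mdist a b))//.
  by rewrite ler_wpM2l// ge_min lexx.
by rewrite ler_piMl ?mdist_ge0// invf_le1// ler1n.
Qed.

Lemma mdist_shift x y : mdist (Defs.shift x) (Defs.shift y) <= 2 * mdist x y.
Proof.
rewrite (mdist_seqspaceE x y) mulrDr !mulrA divff// !mul1r lerDr.
by rewrite le_min mdist_ge0 ler01.
Qed.

End seqspace_distance.

Lemma lipschitz_continuous (R : realType) (T U : metricType R) (f : T -> U)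
    (K : R) :
  (forall x y, mdist (f x) (f y) <= K * mdist x y) -> continuous f.
Proof.
move=> fK x; apply/cvg_ballP => e e0.
have K1 : 0 < `|K| + 1 by rewrite ltr_wpDl.
near=> y; rewrite ballEmdist/= (le_lt_trans (fK _ _))//.
rewrite (@le_lt_trans _ _ ((`|K| + 1) * mdist x y))//.
  rewrite ler_wpM2r ?mdist_ge0// (le_trans (ler_norm K))// lerDl.
  exact: ler01.
rewrite -ltr_pdivlMl//.
near: y; have /(nbhsx_ballx x) : 0 < (`|K| + 1)^-1 * e by rewrite mulr_gt0// invr_gt0.
by rewrite ballEmdist.
Unshelve. all: by end_near. Qed.

Lemma holder_mdist_continuous (R : realType) (T : metricType R) (alpha K : R)
    (F : T -> R) : 0 < alpha -> 0 <= K ->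
  (forall x y, `|F x - F y| <= K * mdist x y `^ alpha) -> continuous F.
Proof.
move=> alpha_gt0 K0 FK x; apply/cvgrPdist_lt => e e0.
have K1 : 0 < K + 1 by rewrite ltr_wpDl.
pose r := (e / (K + 1)) `^ alpha^-1.
have r0 : 0 < r by rewrite powR_gt0// divr_gt0.
near=> y; rewrite (le_lt_trans (FK _ _))//.
rewrite (@le_lt_trans _ _ ((K + 1) * mdist x y `^ alpha))//.
  by rewrite ler_wpM2r ?powR_ge0// lerDl ler01.
rewrite -ltr_pdivlMl// mulrC.
have -> : e / (K + 1) = r `^ alpha.
  by rewrite -powRrM mulVf ?gt_eqF// powRr1// divr_ge0// ltW.
rewrite gt0_ltr_powR// ?nnegrE ?mdist_ge0 ?(ltW r0)//.
near: y; have := nbhsx_ballx x r r0.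
by rewrite ballEmdist.
Unshelve. all: by end_near. Qed.

Lemma ln_le_subr1 (R : realType) (t : R) : 0 < t -> ln t <= t - 1.
Proof. by move=> t0; rewrite lerBrDl -[leRHS](lnK t0) expR_ge1Dx. Qed.

Section holder_functions.
Context {R : realType} {E : completeMetricType R}.
Local Notation X := (@seqspace R E).
Variable alpha : R.
Hypothesis alpha_gt0 : 0 < alpha.
Implicit Types F G : X -> R.

(** Boundedness is not part of the definition: it follows, as the metric is at
    most 1 ([holder_bounded]). *)
Definition holder F :=
  exists K, forall x y, `|F x - F y| <= K * mdist x y `^ alpha.

Lemma holder_ge0 F : holder F ->
  exists2 K, 0 <= K & forall x y, `|F x - F y| <= K * mdist x y `^ alpha.
Proof.
move=> [K FK]; exists `|K| => // x y; apply: (le_trans (FK x y)).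
by rewrite ler_wpM2r ?powR_ge0// ler_norm.
Qed.

Lemma Hol_holder F : Hol alpha F -> holder F.
Proof.
case=> _ Hy; exists (fine (holder_seminorm alpha F)) => x y.
have [->|xy] := pselect (x = y).
  by rewrite subrr normr0 mdistxx powR0 ?gt_eqF// mulr0.
have d0 : 0 < mdist x y `^ alpha.
  by apply: powR_gt0; rewrite mdist_gt0; exact/eqP.
have H : ((`|F x - F y| / mdist x y `^ alpha)%:E <= holder_seminorm alpha F)%E.
  by apply: ereal_sup_ubound; exists (x, y).
rewrite -ler_pdivrMr// -lee_fin fineK// fin_numE.
by rewrite -ltey Hy andbT -ltNye; exact: lt_le_trans (ltNyr _) H.
Qed.

Lemma powR_mdist_le1 (x y : X) : mdist x y `^ alpha <= 1.
Proof.
have -> : 1 = 1 `^ alpha by rewrite powR1.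
rewrite ge0_ler_powR ?nnegrE ?mdist_ge0 ?ler01//.
  exact: ltW.
exact: mdist_seqspace_le1.
Qed.

Lemma holder_bounded F : holder F -> exists M, forall x, `|F x| <= M.
Proof.
move=> /holder_ge0[K K0 FK]; exists (`|F point| + K) => x.
rewrite -[F x](subrK (F point)) (le_trans (ler_normD _ _))// addrC lerD2l.
by rewrite (le_trans (FK _ _))// ler_piMr// powR_mdist_le1.
Qed.

Lemma holder_continuous F : holder F -> continuous F.
Proof. by move=> /holder_ge0[K K0 FK]; exact: holder_mdist_continuous FK. Qed.

Lemma holder_Cb F : holder F -> Cb F.
Proof.
move=> hF; split; first exact: holder_continuous.
have [M FM] := holder_bounded hF; exists M; split; first exact: num_real.
by move=> N MN x _; exact: le_trans (FM x) (ltW MN).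
Qed.

Lemma holder_measurable F :
  holder F -> measurable_fun (setT : set (borelType X)) F.
Proof. by move=> /holder_continuous; exact: continuous_borel. Qed.

Lemma holder_cst (c : R) : holder (fun=> c).
Proof. by exists 0 => x y; rewrite subrr normr0 mul0r. Qed.

Lemma holderD F G : holder F -> holder G -> holder (fun x => F x + G x).
Proof.
move=> [K FK] [L GL]; exists (K + L) => x y.
rewrite opprD addrACA (le_trans (ler_normD _ _))// mulrDl.
by apply: lerD.
Qed.

Lemma holderM F G : holder F -> holder G -> holder (fun x => F x * G x).
Proof.
move=> hF hG; have [M FM] := holder_bounded hF; have [N GN] := holder_bounded hG.
move: hF hG => [K FK] [L GL]; exists (K * N + M * L) => x y.
rewrite (_ : _ - _ = (F x - F y) * G x + F y * (G x - G y)); last by ring.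
rewrite (le_trans (ler_normD _ _))// [leRHS]mulrDl !normrM; apply: lerD.
  by rewrite mulrAC ler_pM.
by rewrite -mulrA ler_pM.
Qed.

Lemma holder_comp F (phi : R -> R) (L : R) : 0 <= L -> holder F ->
  (forall x y, `|phi (F x) - phi (F y)| <= L * `|F x - F y|) ->
  holder (fun x => phi (F x)).
Proof.
move=> L0 [K FK] phiL; exists (L * K) => x y.
by rewrite (le_trans (phiL x y))// -mulrA ler_wpM2l.
Qed.

Lemma holderN F : holder F -> holder (fun x => - F x).
Proof.
move=> hF; apply: (@holder_comp _ -%R 1) => // x y.
by rewrite -opprD normrN mul1r.
Qed.

Lemma holderB F G : holder F -> holder G -> holder (fun x => F x - G x).
Proof. by move=> hF hG; apply: holderD => //; exact: holderN. Qed.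

Lemma holder_expR F : holder F -> holder (fun x => expR (F x)).
Proof.
move=> hF; have [M FM] := holder_bounded hF.
apply: (@holder_comp _ _ (expR M)) => //.
suff key x y : expR (F x) - expR (F y) <= expR M * `|F x - F y|.
  move=> x y; rewrite ler_norml key andbT lerNl opprB.
  by rewrite distrC key.
(* This factor makes 1 - expR t <= - t applicable, with t = F y - F x. *)
have -> : expR (F x) - expR (F y) = expR (F x) * (1 - expR (F y - F x)).
  by rewrite mulrBr mulr1 -expRD; congr (_ - expR _); ring.
apply: (@le_trans _ _ (expR (F x) * `|F x - F y|)).
  rewrite ler_wpM2l ?expR_ge0// (le_trans _ (ler_norm _))//.
  have := expR_ge1Dx (F y - F x); lra.
rewrite ler_wpM2r// ler_expR.
exact: le_trans (ler_norm _) (FM x).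
Qed.

Lemma holder_ln F (c : R) : 0 < c -> (forall x, c <= F x) -> holder F ->
  holder (fun x => ln (F x)).
Proof.
move=> c0 Fc hF; have F0 x : 0 < F x by exact: lt_le_trans (Fc x).
apply: (@holder_comp _ _ c^-1) => //; first by rewrite invr_ge0 ltW.
suff key x y : ln (F x) - ln (F y) <= c^-1 * `|F x - F y|.
  move=> x y; rewrite ler_norml key andbT lerNl opprB.
  by rewrite distrC key.
rewrite -ln_div ?posrE// (le_trans (ln_le_subr1 _))// ?divr_gt0//.
rewrite -[X in _ - X](@divff _ (F y)) ?gt_eqF// -mulrBl mulrC.
apply: (@le_trans _ _ ((F y)^-1 * `|F x - F y|)).
  by rewrite ler_wpM2l ?ler_norm// invr_ge0 ltW.
by rewrite ler_wpM2r// lef_pV2 ?posrE.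
Qed.

End holder_functions.

(** * The Ruelle operator on Hölder functions *)

Lemma probability_Rintegral_cst d (T : measurableType d) (R : realType)
    (P : probability T R) (c : R) : \int[P]_a c = c.
Proof. by rewrite Rintegral_cst//= probability_setT mulr1. Qed.

Lemma probability_Rintegral_le d (T : measurableType d) (R : realType)
    (P : probability T R) (f : T -> R) (c : R) :
  P.-integrable setT (EFin \o f) -> (forall x, f x <= c) -> \int[P]_x f x <= c.
Proof.
move=> fi fc; rewrite -(probability_Rintegral_cst P c); apply: le_Rintegral => //.
exact: finite_measure_integrable_cst.
Qed.

Lemma probability_Rintegral_ge d (T : measurableType d) (R : realType)
    (P : probability T R) (f : T -> R) (c : R) :
  P.-integrable setT (EFin \o f) -> (forall x, c <= f x) -> c <= \int[P]_x f x.
Proof.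
move=> fi fc; rewrite -(probability_Rintegral_cst P c); apply: le_Rintegral => //.
exact: finite_measure_integrable_cst.
Qed.

Section transfer_operator.
Context {R : realType} {E : completeMetricType R}.
Local Notation X := (@seqspace R E).
Variables (p : probability (borelType E) R) (alpha : R).
Hypothesis alpha_gt0 : 0 < alpha.
Implicit Types F G : X -> R.

Lemma prepend_continuous (x : X) : continuous (fun a : E => prepend a x : X).
Proof.
apply: (@lipschitz_continuous _ _ _ _ 1) => a b.
by rewrite mul1r mdist_prependl.
Qed.

Lemma integrable_prepend F (x : X) : holder alpha F ->
  p.-integrable setT (EFin \o (fun a => F (prepend a x))).
Proof.
move=> hF; have [M FM] := holder_bounded alpha_gt0 hF.
apply: measurable_bounded_integrable => //.
- by rewrite (le_lt_trans (probability_le1 p measurableT))// ltry.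
- apply: (@continuous_borel R E (fun a => F (prepend a x))) => a.
  apply: continuous_comp; first exact: prepend_continuous.
  exact: (holder_continuous alpha_gt0 hF).
- exists M; split; first exact: num_real.
  by move=> N MN a _; exact: le_trans (FM _) (ltW MN).
Qed.

Lemma powR_mdist_prepend (a : E) (x y : X) :
  mdist (prepend a x : X) (prepend a y) `^ alpha =
  2^-1 `^ alpha * mdist x y `^ alpha.
Proof. by rewrite mdist_prepend powRM// mdist_ge0. Qed.

(** Prepending a common symbol contracts distances, so averaging over that
    symbol does not increase the Hölder constant. Consequently the
    Ruelle operator maps Hölder functions to bounded continuous ones, against
    which an eigenmeasure can be tested. *)
Lemma holder_average F : holder alpha F ->
  holder alpha (fun x => \int[p]_a F (prepend a x)).
Proof.
move=> hF; have [K K0 FK] := holder_ge0 hF.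
exists (K * 2^-1 `^ alpha) => x y.
have ix := integrable_prepend x hF; have iy := integrable_prepend y hF.
rewrite -RintegralB//; apply: (le_trans (le_normr_Rintegral _ _)) => //.
  exact: (integrableB measurableT ix iy).
apply: probability_Rintegral_le => [|a].
  exact: (integrable_norm (integrableB measurableT ix iy)).
by rewrite -mulrA -(powR_mdist_prepend a).
Qed.

Lemma holder_ruelle F G : holder alpha F -> holder alpha G ->
  holder alpha (ruelle p F G).
Proof.
move=> hF hG; apply: (@holder_average (fun y => expR (F y) * G y)).
by apply: holderM => //; exact: holder_expR.
Qed.

Lemma integrable_ruelle F G (x : X) : holder alpha F -> holder alpha G ->
  p.-integrable setT
    (EFin \o (fun a => expR (F (prepend a x)) * G (prepend a x))).
Proof.
move=> hF hG; apply: (@integrable_prepend (fun y => expR (F y) * G y)).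
by apply: holderM => //; exact: holder_expR.
Qed.

Lemma ruelle_lower_bound F G (c : R) : holder alpha F -> holder alpha G ->
  0 < c -> (forall x, c <= G x) ->
  exists2 c', 0 < c' & forall x, c' <= ruelle p F G x.
Proof.
move=> hF hG c0 Gc; have [M FM] := holder_bounded alpha_gt0 hF.
exists (expR (- M) * c); first by rewrite mulr_gt0 ?expR_gt0.
move=> x; apply: probability_Rintegral_ge => [|a].
  exact: integrable_ruelle.
rewrite ler_pM ?expR_ge0 ?(ltW c0)// ler_expR.
by have := FM (prepend a x); rewrite ler_norml => /andP[].
Qed.

(** Jensen's inequality for ln and the weights
    expR (f (a x)) * h (a x) / (lambda * h x) in a, of total mass 1, applied to
    the function expR (g - f + ln phi - ln h), whose mean is m below. It comes
    from ln t <= t - 1 at t = expR (psi (a x)) / m: after integration the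
    contributions of t and of - 1 cancel. Both sides are multiplied by
    lambda * h x, so that no quotient by h occurs. *)
Lemma ruelle_jensen f g h phi (lambda c d : R) (x : X) :
  holder alpha f -> holder alpha g -> holder alpha h -> holder alpha phi ->
  0 < c -> (forall y, c <= h y) -> 0 < d -> (forall y, d <= phi y) ->
  0 < lambda -> ruelle p f h x = lambda * h x ->
  ruelle p f (fun y => h y * (g y - f y + ln (phi y) - ln (h y))) x <=
  lambda * (h x * (ln (ruelle p g phi x) - ln lambda - ln (h x))).
Proof.
move=> hf hg hh hphi c0 hc d0 phid lambda0 hE.
have h0 y : 0 < h y by exact: lt_le_trans (hc y).
have phi0 y : 0 < phi y by exact: lt_le_trans (phid y).
set psi := fun y => g y - f y + ln (phi y) - ln (h y).
have hpsi : holder alpha psi.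
  apply: holderB; last exact: holder_ln c0 hc hh.
  by apply: holderD; [exact: holderB|exact: holder_ln d0 phid hphi].
have [e e0 /(_ x) Le] := ruelle_lower_bound hg hphi d0 phid.
have L0 : 0 < ruelle p g phi x by exact: lt_le_trans Le.
set L := ruelle p g phi x in L0 *.
pose m := L / (lambda * h x).
have lh0 : 0 < lambda * h x by rewrite mulr_gt0.
have m0 : 0 < m by rewrite divr_gt0.
have pointwise y : expR (f y) * (h y * psi y) <=
    expR (f y) * h y * (ln m - 1) + expR (g y) * phi y * m^-1.
  have w0 : 0 < expR (f y) * h y by rewrite mulr_gt0 ?expR_gt0.
  have -> : expR (g y) * phi y = expR (f y) * h y * expR (psi y).
    rewrite /psi expRB expRD expRB !lnK ?posrE//.
    by field; rewrite !gt_eqF ?expR_gt0.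
  rewrite mulrA -[X in _ + X]mulrA -mulrDr ler_pM2l//.
  have := @ln_le_subr1 _ (expR (psi y) / m) (divr_gt0 (expR_gt0 _) m0).
  rewrite ln_div ?posrE ?expR_gt0// expRK; lra.
have -> : lambda * (h x * (ln L - ln lambda - ln (h x))) =
    lambda * h x * (ln m - 1) + L * m^-1.
  rewrite /m ln_div ?posrE// lnM ?posrE//; field.
  by rewrite !gt_eqF.
rewrite -[in leRHS]hE /L /ruelle.
have i1 := integrable_ruelle x hf hh; have i2 := integrable_ruelle x hg hphi.
have i1' := integrableZr measurableT (ln m - 1) i1.
have i2' := integrableZr measurableT m^-1 i2.
rewrite -!RintegralZr// -RintegralD//.
apply: le_Rintegral => //.
- by apply: (integrable_ruelle (G := fun y => h y * psi y)) => //; exact: holderM.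
- exact: (integrableD measurableT i1' i2').
Qed.

(** The cone of functions whose logarithm is Hölder with constant K is mapped
    into the cone of constant (D + K) 2^-alpha, because the points a x and a y
    are twice as close as x and y. *)
Lemma ruelle_distortion g phi (D K : R) : holder alpha g -> holder alpha phi ->
  (forall x, 0 <= phi x) ->
  (forall x y, `|g x - g y| <= D * mdist x y `^ alpha) ->
  (forall x y, phi x <= expR (K * mdist x y `^ alpha) * phi y) ->
  forall x y, ruelle p g phi x <=
    expR ((D + K) * 2^-1 `^ alpha * mdist x y `^ alpha) * ruelle p g phi y.
Proof.
move=> hg hphi phi0 gD phiK x y; rewrite /ruelle.
have iy := integrable_ruelle y hg hphi.
rewrite -RintegralZl//; apply: le_Rintegral => //.
- exact: integrable_ruelle.
- exact: (integrableZl measurableT _ iy).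
move=> a _; have := phiK (prepend a x) (prepend a y).
have := gD (prepend a x) (prepend a y).
rewrite powR_mdist_prepend; set q := _ * mdist x y `^ alpha => gq phiq.
rewrite -mulrA -/q mulrDl expRD [leRHS]mulrACA.
apply: ler_pM => //.
rewrite -expRD ler_expR -lerBlDr.
exact: le_trans (ler_norm _) gq.
Qed.

End transfer_operator.

(** * Eigenmeasures and the pressure inequality *)

Section eigenmeasures.
Context {R : realType} {E : completeMetricType R}.
Local Notation X := (@seqspace R E).
Local Notation BX := (borelType X).
Variables (p : probability (borelType E) R) (alpha : R).
Hypothesis alpha_gt0 : 0 < alpha.

Lemma fa_integral_probability (nu : probability BX R) (F : BX -> R) (M : R) :
  measurable_fun setT F -> (forall x, `|F x| <= M) ->
  fa_integral nu F = \int[nu]_x F x.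
Proof.
move=> mF FM; rewrite (@fa_integral_density _ _ nu (fun=> 1) nu F M)//.
- by under eq_Rintegral do rewrite mulr1.
- exact: finite_measure_integrable_cst.
- exact: probability_Rintegral_cst.
- by move=> A mA; rewrite integral_cst// mul1e.
Qed.

Lemma integrable_holder (nu : probability BX R) (F : X -> R) :
  holder alpha F -> nu.-integrable setT (EFin \o F).
Proof.
move=> hF; have [M FM] := holder_bounded alpha_gt0 hF.
apply: measurable_bounded_integrable => //.
- by rewrite (le_lt_trans (probability_le1 nu measurableT))// ltry.
- exact: holder_measurable hF.
- exists M; split; first exact: num_real.
  by move=> N MN a _; exact: le_trans (FM _) (ltW MN).
Qed.

Lemma ruelle_eigenmeasure_holder (g phi : X -> R) (lambda : R)
    (nu : probability BX R) :
  ruelle_eigenmeasure p g lambda nu -> holder alpha g -> holder alpha phi ->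
  \int[nu]_x ruelle p g phi x = lambda * \int[nu]_x phi x.
Proof.
move=> nuE hg hphi; have hL := holder_ruelle p alpha_gt0 hg hphi.
have [M phiM] := holder_bounded alpha_gt0 hphi.
have [N LN] := holder_bounded alpha_gt0 hL.
have := nuE phi (holder_Cb alpha_gt0 hphi); rewrite /ruelle_dual.
rewrite (fa_integral_probability nu (holder_measurable alpha_gt0 hL) LN).
by rewrite (fa_integral_probability nu (holder_measurable alpha_gt0 hphi) phiM).
Qed.

(** For K = D r / (1 - r) with r = 2^-alpha, a fixed point of K |-> (D + K) r,
    the cone of [ruelle_distortion] is invariant; it contains 1, hence all
    iterates. Since distances are at most 1, each value of an iterate is at most
    expR K times any other value, so also at most expR K times the nu-mean
    lambda ^+ n. *)
Lemma ruelle_iterates_bound (g : X -> R) (lambda : R) (nu : probability BX R) :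
  ruelle_eigenmeasure p g lambda nu -> holder alpha g ->
  exists K : R, forall n, let u := iter n (ruelle p g) (fun=> 1) in
    [/\ holder alpha u, exists2 c, 0 < c & forall x, c <= u x &
        forall x, u x <= expR K * lambda ^+ n].
Proof.
move=> nuE hg; have [D D0 gD] := holder_ge0 hg.
pose r : R := 2^-1 `^ alpha.
have r0 : 0 < r by rewrite powR_gt0.
have r1 : r < 1.
  have -> : 1 = 1 `^ alpha :> R by rewrite powR1.
  by rewrite gt0_ltr_powR ?nnegrE ?invf_lt1 ?ltr1n ?invr_ge0.
pose K := D * r / (1 - r).
have K0 : 0 <= K by rewrite divr_ge0 ?mulr_ge0 ?subr_ge0// ltW.
have KE : (D + K) * r = K.
  by rewrite /K; field; rewrite subr_eq0 gt_eqF.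
have inv n : let u := iter n (ruelle p g) (fun=> 1) in
    [/\ holder alpha u, exists2 c, 0 < c & forall x, c <= u x &
        forall x y, u x <= expR (K * mdist x y `^ alpha) * u y].
  elim: n => [|n [hu [c c0 uc] uK]] /=.
    split; [exact: holder_cst|by exists 1|].
    move=> x y; rewrite mulr1 -[leLHS]expR0 ler_expR.
    by rewrite mulr_ge0 ?powR_ge0.
  have u0 x : 0 <= iter n (ruelle p g) (fun=> 1) x.
    exact: le_trans (ltW c0) (uc x).
  split; [exact: holder_ruelle|exact: ruelle_lower_bound hg hu c0 uc|].
  move=> x y; have := ruelle_distortion p alpha_gt0 hg hu u0 gD uK x y.
  by rewrite -/r KE.
exists K => n /=; have [hu uc uK] := inv n; split => // x.
have mass : \int[nu]_x iter n (ruelle p g) (fun=> 1) x = lambda ^+ n.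
  elim: n {hu uc uK} => [|n IH]; first exact: probability_Rintegral_cst.
  have [hu _ _] := inv n.
  by rewrite [in LHS]iterS (ruelle_eigenmeasure_holder nuE hg hu) IH exprS.
rewrite -mass -(RintegralZl _ measurableT (integrable_holder nu hu)).
apply: probability_Rintegral_ge => [|y].
  exact: (integrableZl measurableT _ (integrable_holder nu hu)).
rewrite (le_trans (uK x y))// ler_wpM2r//.
  by have [c c0 ?] := uc; exact: le_trans (ltW c0) _.
by rewrite ler_expR ler_piMr// powR_mdist_le1.
Qed.

(** [step] is the Jensen inequality integrated against h nu: the integral of
    the averaged function is computed by the eigenmeasure property of nu, and
    the terms ln h on the two sides cancel. Iterating it from the constant 1 and
    comparing with the upper bound on the iterates gives an inequality up to a
    constant K independent of n, which disappears as n grows. *)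
Lemma pressure_subgradient (f g h : X -> R) (lambda lambda_g c : R)
    (nu nu_g : probability BX R) :
  holder alpha f -> holder alpha g -> holder alpha h ->
  0 < lambda -> 0 < lambda_g -> 0 < c -> (forall x, c <= h x) ->
  (forall x, ruelle p f h x = lambda * h x) -> \int[nu]_x h x = 1 ->
  ruelle_eigenmeasure p f lambda nu -> ruelle_eigenmeasure p g lambda_g nu_g ->
  ln lambda + \int[nu]_x ((g x - f x) * h x) <= ln lambda_g.
Proof.
move=> hf hg hh l0 lg0 c0 hc hE h1 nuE nugE.
have h0 x : 0 < h x by exact: lt_le_trans (hc x).
have hlnh := holder_ln c0 hc hh.
have [K uK] := ruelle_iterates_bound nugE hg.
pose I F := \int[nu]_x (F x * h x).
have IM F : holder alpha F ->
    nu.-integrable setT (EFin \o (fun x => F x * h x)).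
  by move=> hF; apply: integrable_holder; exact: holderM.
have ID F G : holder alpha F -> holder alpha G ->
    I (fun x => F x + G x) = I F + I G.
  move=> hF hG; rewrite /I -RintegralD//; [|exact: IM..].
  by apply: eq_Rintegral => x _; rewrite mulrDl.
have Icst k : I (fun=> k) = k.
  by rewrite /I RintegralZl ?h1 ?mulr1//; exact: integrable_holder.
have step phi d : holder alpha phi -> 0 < d -> (forall x, d <= phi x) ->
    ln lambda + I (fun x => g x - f x) + I (fun x => ln (phi x)) <=
    I (fun x => ln (ruelle p g phi x)).
  move=> hphi d0 phid.
  have hlnphi := holder_ln d0 phid hphi.
  have hL := holder_ruelle p alpha_gt0 hg hphi.
  have [e e0 Le] := ruelle_lower_bound p alpha_gt0 hg hphi d0 phid.
  have hlnL := holder_ln e0 Le hL.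
  pose psi x := g x - f x + ln (phi x) - ln (h x).
  have hpsi : holder alpha psi.
    by apply: holderB => //; apply: holderD => //; exact: holderB.
  have hhpsi : holder alpha (fun x => h x * psi x) by exact: holderM.
  pose chi x := ln (ruelle p g phi x) - ln lambda - ln (h x).
  have hchi : holder alpha chi.
    by apply: holderB => //; apply: holderB => //; exact: holder_cst.
  have Ipsichi : I psi <= I chi.
    rewrite -(ler_pM2l l0).
    have -> : lambda * I psi = \int[nu]_x ruelle p f (fun y => h y * psi y) x.
      rewrite (ruelle_eigenmeasure_holder nuE hf hhpsi); congr (_ * _).
      by apply: eq_Rintegral => x _; rewrite mulrC.
    rewrite -RintegralZl//; last exact: IM.
    apply: le_Rintegral => //.
    - by apply: integrable_holder; exact: holder_ruelle.
    - exact: (integrableZl measurableT _ (IM _ hchi)).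
    - move=> x _; rewrite [chi x * _]mulrC.
      exact: (ruelle_jensen alpha_gt0 hf hg hh hphi c0 hc d0 phid l0 (hE x)).
  move: Ipsichi.
  have -> : I psi = I (fun x => g x - f x) + I (fun x => ln (phi x)) +
      I (fun x => - ln (h x)).
    rewrite -ID//; last by exact: holderB.
    rewrite -ID//; last by exact: holderN.
    by apply: holderD => //; exact: holderB.
  have -> : I chi = I (fun x => ln (ruelle p g phi x)) - ln lambda +
      I (fun x => - ln (h x)).
    rewrite -[X in _ + X + _]Icst -ID//; last exact: holder_cst.
    rewrite -ID//; last by exact: holderN.
    by apply: holderD => //; exact: holder_cst.
  lra.
set J := I (fun x => g x - f x) in step *; rewrite -[\int[nu]_x _]/J.
have iterate n : n%:R * (ln lambda + J) <=
    I (fun x => ln (iter n (ruelle p g) (fun=> 1) x)).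
  elim: n => [|n IH]; first by rewrite mul0r /= ln1 Icst.
  have [hu [d d0 ud] _] := uK n.
  have := step _ _ hu d0 ud; move: IH; rewrite -natr1 mulrDl mul1r /=; lra.
have upper n : n%:R * (ln lambda + J - ln lambda_g) <= K.
  have [hu [d d0 ud] un] := uK n.
  suff : I (fun x => ln (iter n (ruelle p g) (fun=> 1) x)) <=
      K + n%:R * ln lambda_g by have := iterate n; lra.
  rewrite -[leRHS]Icst; apply: le_Rintegral => //.
  - exact/IM/(holder_ln d0 ud hu).
  - exact/IM/holder_cst.
  - move=> x _; rewrite ler_wpM2r ?(ltW (h0 x))//.
    rewrite mulr_natl -lnXn// -[K in leRHS]expRK -lnM ?posrE ?expR_gt0 ?exprn_gt0//.
    by rewrite ler_ln ?posrE ?mulr_gt0 ?expR_gt0 ?exprn_gt0// (lt_le_trans d0).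
rewrite -subr_le0 leNgt; apply/negP => s0.
have := upper (Num.truncn (K / (ln lambda + J - ln lambda_g))).+1.
by rewrite leNgt -ltr_pdivrMr// truncnS_gt.
Qed.

End eigenmeasures.

(** * The equilibrium state *)

Section equilibrium_state.
Context {R : realType} {E : completeMetricType R}.
Local Notation X := (@seqspace R E).
Local Notation BX := (borelType X).

Lemma Cb_bounded (phi : X -> R) : Cb phi -> exists M, forall x, `|phi x| <= M.
Proof.
move=> [_ [M [_ phiM]]]; exists (`|M| + 1) => x; apply: phiM => //.
by rewrite (le_lt_trans (ler_norm M))// ltrDl.
Qed.

Lemma Cb_measurable (phi : X -> R) :
  Cb phi -> measurable_fun (setT : set BX) (phi : BX -> R).
Proof. by case=> /continuous_borel. Qed.

Lemma CbM (phi psi : X -> R) : Cb phi -> Cb psi -> Cb (fun x => phi x * psi x).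
Proof.
move=> Cphi Cpsi; have [cphi _] := Cphi; have [cpsi _] := Cpsi.
split; first by move=> x; exact: (cvgM (cphi x) (cpsi x)).
have [M phiM] := Cb_bounded Cphi; have [N psiN] := Cb_bounded Cpsi.
exists (M * N); split; first exact: num_real.
by move=> K MNK x _; rewrite /= normrM (le_trans _ (ltW MNK))// ler_pM.
Qed.

Lemma shift_continuous : continuous (@Defs.shift R E).
Proof. exact: lipschitz_continuous (@mdist_shift R E). Qed.

Lemma Cb_shift (phi : X -> R) : Cb phi -> Cb (phi \o @Defs.shift R E).
Proof.
move=> Cphi; have [cphi _] := Cphi; split.
  move=> x; apply: continuous_comp; first exact: shift_continuous.
  exact: cphi.
have [M phiM] := Cb_bounded Cphi; exists M; split; first exact: num_real.
by move=> N MN x _; exact: le_trans (phiM _) (ltW MN).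
Qed.

Lemma measure_rba (mu : {additive_charge set BX -> \bar R})
    (m : {measure set BX -> \bar R}) :
  (m setT < +oo)%E -> (forall A, measurable A -> mu A = m A) -> rba mu.
Proof.
move=> mfin muE; split.
  exists (fine (m setT)) => A mA.
  rewrite fineK ?ge0_fin_numE// muE// gee0_abs//.
  by apply: le_measure; rewrite ?inE.
move=> A e mA e0; have [F [U [cF FA oU AU FU]]] := borel_measure_regular mfin mA e0.
exists F, U; split => // C mC CUF; rewrite muE// gee0_abs// (le_lt_trans _ FU)//.
apply: le_measure; rewrite ?inE//.
by apply: measurableD; [exact: open_borel|exact: closed_borel].
Qed.

(** In (phi \o shift) * h the first factor does not see the prepended symbol, so
    it comes out of the Ruelle operator: the image is phi * L_f h, that is
    lambda * phi * h. The eigenmeasure identity for this test function is then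
    invariance, multiplied by lambda. *)
Lemma eigenmeasure_shift_invariant (p : probability (borelType E) R) (alpha : R)
    (f h phi : X -> R) (lambda : R) (nu : probability BX R) :
  0 < alpha -> 0 < lambda -> holder alpha f -> holder alpha h -> Cb phi ->
  ruelle_eigenmeasure p f lambda nu ->
  (forall x, ruelle p f h x = lambda * h x) ->
  \int[nu]_x (phi (Defs.shift x) * h x) = \int[nu]_x (phi x * h x).
Proof.
move=> alpha0 lambda0 hf hh Cphi nuE Lh; have Ch := holder_Cb alpha0 hh.
pose psi x := phi (Defs.shift x) * h x.
have Cpsi : Cb psi by apply: CbM => //; exact: Cb_shift.
have Cphih : Cb (fun x => phi x * h x) by exact: CbM.
have Lpsi : ruelle p f psi = fun x => lambda * (phi x * h x).
  apply/funext => x; rewrite mulrCA -Lh /ruelle.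
  rewrite -RintegralZl//; last exact: (integrable_ruelle p alpha0 x hf hh).
  by apply: eq_Rintegral => a _; rewrite mulrCA.
have [M psiM] := Cb_bounded Cpsi; have [N phihN] := Cb_bounded Cphih.
have LpsiN x : `|lambda * (phi x * h x)| <= lambda * N.
  by rewrite normrM gtr0_norm// ler_pM2l.
have := nuE psi Cpsi; rewrite /ruelle_dual Lpsi.
rewrite (fa_integral_probability nu _ LpsiN); last first.
  by apply: measurable_funM => //; exact: (Cb_measurable Cphih).
rewrite (fa_integral_probability nu (Cb_measurable Cpsi) psiM).
rewrite RintegralZl//; last first.
  apply: measurable_bounded_integrable => //.
  - by rewrite (le_lt_trans (probability_le1 nu measurableT))// ltry.
  - exact: (Cb_measurable Cphih).
  - by have [] := Cphih.
by move/(mulfI (lt0r_neq0 lambda0)) => ->.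
Qed.

End equilibrium_state.

Theorem theorem4p9 (R : realType) (E : completeMetricType R)
    (Esep : separable E) (p : probability (borelType E) R)
    (alpha : R) (alpha01 : 0 < alpha < 1)
    (f : seqspace E -> R) (fHol : Hol alpha f)
    (lambda : R) (lambda_gt0 : 0 < lambda)
    (nu : probability (borelType (seqspace E)) R)
    (nuE : ruelle_eigenmeasure p f lambda nu)
    (h : seqspace E -> R) (hE : ruelle_eigenfunction p alpha f lambda h)
    (h1 : \int[nu]_x h x = 1) :
  exists mu : {additive_charge set (borelType (seqspace E)) -> \bar R},
    [/\ forall A : set (borelType (seqspace E)), measurable A ->
          mu A = (\int[nu]_(x in A) (h x)%:E)%E,
        equilibrium_state p alpha f mu &
        only_countably_additive mu].
Proof.
have /andP[alpha0 _] := alpha01.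
have [hHol [c c0 hc] Lh] := hE.
have hh := Hol_holder alpha0 hHol; have hf := Hol_holder alpha0 fHol.
have h0 x : 0 <= h x by exact: le_trans (ltW c0) (hc x).
have ih := integrable_holder alpha0 nu hh.
pose mu : {additive_charge set (borelType (seqspace E)) -> \bar R} :=
  induced_charge ih.
have muE A : measurable A -> mu A = (\int[nu]_(x in A) (h x)%:E)%E by [].
have mu_ge0 A : (0 <= induced_charge ih A)%E.
  by apply: integral_ge0 => x _; rewrite lee_fin.
pose m : {measure set (borelType (seqspace E)) -> \bar R} :=
  measure_of_charge (induced_charge ih) mu_ge0.
have mfin : (m setT < +oo)%E by exact: integrable_lty.
have faE (F : seqspace E -> R) (M : R) :
    measurable_fun (setT : set (borelType (seqspace E))) F ->
    (forall x, `|F x| <= M) -> fa_integral mu F = \int[nu]_x (F x * h x).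
  exact: fa_integral_density.
have rba_mu : rba mu by exact: (@measure_rba _ _ mu m).
have M1a_mu : M1a mu.
  split => //.
    rewrite (faE _ 1)//; last by move=> x; rewrite normr1.
    by under eq_Rintegral do rewrite mul1r.
  move=> phi phiC phi0; have [M phiM] := Cb_bounded phiC.
  rewrite (faE _ M)//; last exact: Cb_measurable.
  by apply: Rintegral_ge0 => x _; rewrite mulr_ge0.
have Msigma_mu : Msigma mu.
  split => // phi phiC; have [M phiM] := Cb_bounded phiC.
  rewrite (faE _ M (Cb_measurable (Cb_shift phiC)) (fun x => phiM (Defs.shift x))).
  rewrite (faE _ M (Cb_measurable phiC) phiM).
  exact: (eigenmeasure_shift_invariant alpha0 lambda_gt0 hf hh phiC nuE Lh).
exists mu; split => //; last first.
  (* the decomposition mu = mu + 0 *)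
  exists mu, (@czero _ _ _); split => //; split => //.
  - split => //; apply: (@measure_rba _ _ _ mzero) => //.
    by rewrite /mzero ltry.
  - by move=> A mA; rewrite adde0.
  - by split; [move=> A _; exact: mu_ge0|exact: charge_semi_sigma_additive].
  - split => // kappa kappa0 A mA; apply/eqP; rewrite eq_le measure_ge0 andbT.
    exact: kappa0.
(* The infimum defining the entropy is evaluated at g = f. *)
have upper kappa : (entropy p alpha kappa + (fa_integral kappa f)%:E <=
    (ln lambda)%:E)%E.
  rewrite -leeBrDr// -EFinB; apply: ereal_inf_lbound.
  exists (f, lambda); first by split => //; split => //; exists nu.
  by rewrite /= addrC.
have lower : ((ln lambda)%:E <= entropy p alpha mu + (fa_integral mu f)%:E)%E.
  rewrite -leeBlDr// -EFinB; apply: le_ereal_inf_tmp.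
  move=> _ [[g lg] /= [gHol [lg0 [nug nugE]]] <-].
  have hg := Hol_holder alpha0 gHol.
  have [M fM] := holder_bounded alpha0 hf.
  have [N gN] := holder_bounded alpha0 hg.
  rewrite (faE f M)//; last exact: holder_measurable hf.
  rewrite (faE g N)//; last exact: holder_measurable hg.
  have := pressure_subgradient alpha0 hf hg hh lambda_gt0 lg0 c0 hc Lh h1 nuE nugE.
  rewrite lee_fin; under eq_Rintegral do rewrite mulrBl.
  rewrite RintegralB//; [lra|..].
  - exact: (integrable_holder alpha0 nu (holderM alpha0 hg hh)).
  - exact: (integrable_holder alpha0 nu (holderM alpha0 hf hh)).
split => //; apply/eqP; rewrite eq_le; apply/andP; split.
  by apply: ereal_sup_ubound; exists mu.
apply: (le_trans _ lower); apply: ge_ereal_sup => _ [kappa _ <-].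
exact: upper.
Qed.
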